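(* Let $G$ be an ordered abelian group which is not divisible. Then the Grothendieck ring of definable sets of $G$ is trivial: $\mathrm{K}\,G = 0$.
   Context: An ordered abelian group is an abelian group $G$ with a translation-invariant total order; it is regarded as a first-order structure in the language $\mathcal{L}_{\mathrm{oag}} = \{0,+,-,<\}$. ''Definable in $G$'' means $\mathcal{L}_{\mathrm{oag}}(G)$-definable, i.e. first-order definable with parameters from $G$. Write $\mathrm{Def}(G)$ for the collection of all definable subsets of $G^n$, for $n \in \mathbb{N}$. A map between definable sets is definable if its graph is a definable set. The (model-theoretic) Grothendieck ring $\mathrm{K}\,G$ is the following ring. Its underlying abelian group has generators $[A]$ for all $A \in \mathrm{Def}(G)$, subject to the relations: (i) $[A] = [B]$ whenever there exists a definable bijection $A \to B$ (where $A$ and $B$ may lie in different powers of $G$); (ii) $[A \setminus B] + [B] = [A]$ for all $A, B \in \mathrm{Def}(G)$ with $B \subseteq A$. Multiplication is induced by the cartesian product: $[A]\cdot[B] = [A \times B]$. The zero element is $[\emptyset]$ and the unit is $1 = [\{a\}]$ for any $a \in G$. $G$ is $n$-divisible, for an integer $n\ge 1$, if for every $g \in G$ there is $h \in G$ with $nh = g$; $G$ is divisible if it is $n$-divisible for every integer $n \geq 1$. *)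

(* Defs.v *)
From HB Require Import structures.
From mathcomp Require Import all_boot all_order all_algebra.
From mathcomp Require Import boolp classical_sets functions.
From mathcomp Require Import freeg.

Set Implicit Arguments.
Unset Strict Implicit.
Unset Printing Implicit Defensive.

Import Order.TTheory GRing.Theory.

Local Open Scope classical_set_scope.
Local Open Scope quotient_scope.
Local Open Scope ring_scope.

(* Totality is a field rather than inherited from [Order.Total]: the join of
   [Order.Total] and [GRing.Zmodule] cannot be declared below
   [Num.RealDomain]. *)
HB.mixin Record isOrderedAbelianGroup G of Num.POrderedZmodule G := {
  oag_le_total : total (<=%R : rel G);
  oag_leD2l : forall z x y : G, x <= y -> z + x <= z + y
}.

#[short(type="oagType")]
HB.structure Definition OrderedAbelianGroup :=
  {G of Num.POrderedZmodule G & isOrderedAbelianGroup G}.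

Definition n_divisible (n : nat) (G : zmodType) : Prop :=
  forall g : G, exists h : G, h *+ n = g.

Definition divisible (G : zmodType) : Prop :=
  forall n : nat, (1 <= n)%N -> n_divisible n G.

(* Terms and formulas of {0, +, -, <} with parameters from [G] ([TCst]), over
   the variables 'I_n. Quantifiers bind variable 0 of a formula over 'I_n.+1,
   the other variables being shifted by one. *)
Inductive oag_term (G : Type) (n : nat) : Type :=
| TVar of 'I_n
| TCst of G
| TZero
| TAdd of oag_term G n & oag_term G n
| TOpp of oag_term G n.

Arguments TVar {G n}.
Arguments TCst {G n}.
Arguments TZero {G n}.

Inductive oag_formula (G : Type) (n : nat) : Type :=
| FEq of oag_term G n & oag_term G n
| FLt of oag_term G n & oag_term G n
| FNot of oag_formula G n
| FAnd of oag_formula G n & oag_formula G n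
| FOr of oag_formula G n & oag_formula G n
| FImp of oag_formula G n & oag_formula G n
| FAll of oag_formula G n.+1
| FEx of oag_formula G n.+1.

Section Semantics.
Variable G : oagType.

Fixpoint eval n (e : n.-tuple G) (t : oag_term G n) : G :=
  match t with
  | TVar i => tnth e i
  | TCst g => g
  | TZero => 0
  | TAdd t1 t2 => eval e t1 + eval e t2
  | TOpp t1 => - eval e t1
  end.

Fixpoint holds n (f : oag_formula G n) : n.-tuple G -> Prop :=
  match f with
  | FEq t1 t2 => fun e => eval e t1 = eval e t2
  | FLt t1 t2 => fun e => eval e t1 < eval e t2
  | FNot f1 => fun e => ~ holds f1 e
  | FAnd f1 f2 => fun e => holds f1 e /\ holds f2 e
  | FOr f1 f2 => fun e => holds f1 e \/ holds f2 e
  | FImp f1 f2 => fun e => holds f1 e -> holds f2 e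
  | FAll f1 => fun e => forall x : G, holds f1 (cons_tuple x e)
  | FEx f1 => fun e => exists x : G, holds f1 (cons_tuple x e)
  end.

Definition definable n (A : set (n.-tuple G)) : Prop :=
  exists f : oag_formula G n, A = [set e | holds f e].

Definition graph_on m n (A : set (m.-tuple G)) (f : m.-tuple G -> n.-tuple G) :
  set ((m + n).-tuple G) := [set cat_tuple x (f x) | x in A].

(* [f] is total on G^m for convenience; only its restriction to [A] matters. *)
Definition definable_bijection m n (A : set (m.-tuple G)) (B : set (n.-tuple G)) :
  Prop := exists2 f : m.-tuple G -> n.-tuple G,
    set_bij A B f & definable (graph_on A f).

Definition cart m n (A : set (m.-tuple G)) (B : set (n.-tuple G)) :
  set ((m + n).-tuple G) := [set cat_tuple x y | x in A & y in B].

Definition reindex m n (r : 'I_n -> 'I_m) (e : m.-tuple G) : n.-tuple G :=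
  [tuple tnth e (r i) | i < n].

End Semantics.

Section Renaming.
Variable G : oagType.

Fixpoint ren_term m n (r : 'I_n -> 'I_m) (t : oag_term G n) : oag_term G m :=
  match t with
  | TVar i => TVar (r i)
  | TCst g => TCst g
  | TZero => TZero
  | TAdd t1 t2 => TAdd (ren_term r t1) (ren_term r t2)
  | TOpp t1 => TOpp (ren_term r t1)
  end.

Definition ren_up m n (r : 'I_n -> 'I_m) (i : 'I_n.+1) : 'I_m.+1 :=
  if unlift ord0 i is Some j then fintype.lift ord0 (r j) else ord0.

Fixpoint ren m n (r : 'I_n -> 'I_m) (f : oag_formula G n) : oag_formula G m :=
  match f with
  | FEq t1 t2 => FEq (ren_term r t1) (ren_term r t2)
  | FLt t1 t2 => FLt (ren_term r t1) (ren_term r t2)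
  | FNot f1 => FNot (ren r f1)
  | FAnd f1 f2 => FAnd (ren r f1) (ren r f2)
  | FOr f1 f2 => FOr (ren r f1) (ren r f2)
  | FImp f1 f2 => FImp (ren r f1) (ren r f2)
  | FAll f1 => FAll (ren (ren_up r) f1)
  | FEx f1 => FEx (ren (ren_up r) f1)
  end.

Lemma tnth_reindex m n (r : 'I_n -> 'I_m) (e : m.-tuple G) i :
  tnth (reindex r e) i = tnth e (r i).
Proof. by rewrite tnth_mktuple. Qed.

Lemma eval_ren m n (r : 'I_n -> 'I_m) t (e : m.-tuple G) :
  eval e (ren_term r t) = eval (reindex r e) t.
Proof. by elim: t => //= [i|t1 -> t2 ->|t1 ->] //; rewrite tnth_reindex. Qed.

Lemma reindex_up m n (r : 'I_n -> 'I_m) (e : m.-tuple G) x :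
  reindex (ren_up r) (cons_tuple x e) = cons_tuple x (reindex r e).
Proof.
apply: eq_from_tnth => i; rewrite tnth_reindex /ren_up.
case: unliftP => [j ->|->] /=; first by rewrite !tnthS tnth_reindex.
by rewrite !tnth0.
Qed.

Lemma holds_ren m n (r : 'I_n -> 'I_m) f (e : m.-tuple G) :
  holds (ren r f) e <-> holds f (reindex r e).
Proof.
elim: f m r e => {n} /=.
- by move=> n t1 t2 m r e; rewrite !eval_ren.
- by move=> n t1 t2 m r e; rewrite !eval_ren.
- by move=> n f IH m r e; rewrite IH.
- by move=> n f IHf g IHg m r e; rewrite IHf IHg.
- by move=> n f IHf g IHg m r e; rewrite IHf IHg.
- by move=> n f IHf g IHg m r e; rewrite IHf IHg.
- by move=> n f IH m r e; split=> H x; have := H x; rewrite IH reindex_up.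
- by move=> n f IH m r e; split=> -[x H]; exists x; move: H; rewrite IH reindex_up.
Qed.

Lemma definable_ext n (A B : set (n.-tuple G)) :
  definable A -> (forall x, A x <-> B x) -> definable B.
Proof. by move=> dA /predeqP <-. Qed.

Lemma definable_reindex m n (r : 'I_n -> 'I_m) (A : set (n.-tuple G)) :
  definable A -> definable [set e | A (reindex r e)].
Proof.
case=> f ->; exists (ren r f); apply/seteqP.
by split=> e /=; rewrite holds_ren.
Qed.

Lemma definableI n (A B : set (n.-tuple G)) :
  definable A -> definable B -> definable (A `&` B).
Proof. by move=> [f ->] [g ->]; exists (FAnd f g). Qed.

Lemma definableC n (A : set (n.-tuple G)) : definable A -> definable (~` A).
Proof. by move=> [f ->]; exists (FNot f). Qed.

Lemma definableD n (A B : set (n.-tuple G)) :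
  definable A -> definable B -> definable (A `\` B).
Proof. by move=> dA dB; rewrite setDE; apply/definableI/definableC. Qed.

Lemma definable_setT n : definable [set: n.-tuple G].
Proof.
by exists (FEq TZero TZero); apply/seteqP; split.
Qed.

Lemma definable_set0 n : definable (set0 : set (n.-tuple G)).
Proof. by rewrite -setCT; apply/definableC/definable_setT. Qed.

Lemma definable_eqs m n (r s : 'I_n -> 'I_m) :
  definable [set e : m.-tuple G | reindex r e = reindex s e].
Proof.
apply: (@definable_ext _ [set e : m.-tuple G |
    forall i, i \in enum 'I_n -> tnth e (r i) = tnth e (s i)]).
  elim: (enum 'I_n) => [|i l IH].
    by apply: definable_ext (@definable_setT m) _ => e; split.
  have di : definable [set e : m.-tuple G | tnth e (r i) = tnth e (s i)].
    by exists (FEq (TVar (r i)) (TVar (s i))).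
  apply: definable_ext (definableI di IH) _ => e; split=> /=.
    by move=> [ei H] j; rewrite inE => /predU1P[->|/H].
  by move=> H; split=> [|j jl]; apply: H; rewrite inE ?eqxx // jl orbT.
move=> e; split=> /= [H|H i _]; last by rewrite -!tnth_reindex H.
by apply: eq_from_tnth => i; rewrite !tnth_reindex H // mem_enum.
Qed.

Lemma reindex_lshift m n (x : m.-tuple G) (y : n.-tuple G) :
  reindex (@lshift m n) (cat_tuple x y) = x.
Proof. by apply: eq_from_tnth => i; rewrite tnth_reindex tnth_lshift. Qed.

Lemma reindex_rshift m n (x : m.-tuple G) (y : n.-tuple G) :
  reindex (@rshift m n) (cat_tuple x y) = y.
Proof. by apply: eq_from_tnth => i; rewrite tnth_reindex tnth_rshift. Qed.

Lemma cat_reindex m n (z : (m + n).-tuple G) :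
  cat_tuple (reindex (@lshift m n) z) (reindex (@rshift m n) z) = z.
Proof.
apply: eq_from_tnth => i; rewrite -[i]splitK; case: (fintype.split i) => j /=.
  by rewrite tnth_lshift tnth_reindex.
by rewrite tnth_rshift tnth_reindex.
Qed.

Lemma reindex_comp m n p (r : 'I_n -> 'I_m) (s : 'I_p -> 'I_n) (e : m.-tuple G) :
  reindex s (reindex r e) = reindex (r \o s) e.
Proof. by apply: eq_from_tnth => i; rewrite !tnth_reindex. Qed.

Lemma cartE m n (A : set (m.-tuple G)) (B : set (n.-tuple G)) z :
  cart A B z <-> A (reindex (@lshift m n) z) /\ B (reindex (@rshift m n) z).
Proof.
split=> [[x Ax [y By <-]]|[Az Bz]].
  by rewrite reindex_lshift reindex_rshift.
by exists (reindex (@lshift m n) z) => //; exists (reindex (@rshift m n) z) => //;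
  rewrite cat_reindex.
Qed.

Lemma definable_cart m n (A : set (m.-tuple G)) (B : set (n.-tuple G)) :
  definable A -> definable B -> definable (cart A B).
Proof.
move=> dA dB; have := definableI (definable_reindex (@lshift m n) dA)
  (definable_reindex (@rshift m n) dB).
by move/definable_ext; apply => z; rewrite cartE.
Qed.

Lemma graph_onE m n (A : set (m.-tuple G)) (f : m.-tuple G -> n.-tuple G) z :
  graph_on A f z <-> A (reindex (@lshift m n) z) /\
    reindex (@rshift m n) z = f (reindex (@lshift m n) z).
Proof.
split=> [[x Ax <-]|[Az fz]].
  by rewrite reindex_lshift reindex_rshift.
by exists (reindex (@lshift m n) z) => //; rewrite -fz cat_reindex.
Qed.

Lemma definable_bij_reindex m n (r : 'I_n -> 'I_m) (A : set (m.-tuple G))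
    (B : set (n.-tuple G)) :
  definable A -> set_bij A B (reindex r) -> definable_bijection A B.
Proof.
move=> dA bij; exists (reindex r) => //.
have := definableI (definable_reindex (@lshift m n) dA)
  (definable_eqs (@rshift m n) (@lshift m n \o r)).
by move/definable_ext; apply => z; rewrite graph_onE reindex_comp.
Qed.

Lemma definable_bijection_cart m n p (A : set (m.-tuple G))
    (B : set (n.-tuple G)) (C : set (p.-tuple G)) :
  definable C ->
  definable_bijection A B -> definable_bijection (cart A C) (cart B C).
Proof.
move=> dC [f [fAB finj fsurj] df].
pose L := @lshift m p; pose R := @rshift m p.
exists (fun z => cat_tuple (f (reindex L z)) (reindex R z)).
  split.
  - move=> z /cartE[Az Cz]; apply/cartE.
    by rewrite reindex_lshift reindex_rshift; split => //; apply: fAB.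
  - move=> z z' /set_mem/cartE[Az Cz] /set_mem/cartE[Az' Cz'] E.
    have := congr1 (reindex (@lshift n p)) E; rewrite !reindex_lshift => /finj E1.
    have := congr1 (reindex (@rshift n p)) E; rewrite !reindex_rshift => E2.
    rewrite -[z]cat_reindex -[z']cat_reindex -/L -/R E2 E1 //; exact/mem_set.
  - move=> w /cartE[Bw Cw]; have [x Ax fx] := fsurj _ Bw.
    exists (cat_tuple x (reindex (@rshift n p) w)).
      by apply/cartE; rewrite reindex_lshift reindex_rshift.
    by rewrite reindex_lshift reindex_rshift fx cat_reindex.
pose rA : 'I_m -> 'I_((m + p) + (n + p)) := @lshift (m + p) (n + p) \o L.
pose rC : 'I_p -> 'I_((m + p) + (n + p)) := @lshift (m + p) (n + p) \o R.
pose rB : 'I_n -> 'I_((m + p) + (n + p)) := @rshift (m + p) (n + p) \o @lshift n p.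
pose rD : 'I_p -> 'I_((m + p) + (n + p)) := @rshift (m + p) (n + p) \o @rshift n p.
pose rAB (i : 'I_(m + n)) := match fintype.split i with inl j => rA j | inr j => rB j end.
have rABl : rAB \o @lshift m n = rA.
  by apply/funext => i; rewrite /rAB /= (unsplitK (inl i)).
have rABr : rAB \o @rshift m n = rB.
  by apply/funext => i; rewrite /rAB /= (unsplitK (inr i)).
have := definableI (definable_reindex rAB df)
  (definableI (definable_reindex rC dC) (definable_eqs rD rC)).
move/definable_ext; apply=> w; rewrite graph_onE cartE !reindex_comp -/rA -/rC /=.
rewrite graph_onE !reindex_comp rABl rABr; split.
  move=> [[Aw Bw] [Cw Dw]]; split => //; rewrite -[LHS]cat_reindex.
  by rewrite !reindex_comp -/rB -/rD Bw Dw.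
move=> [[Aw Cw] E]; split; first split => //; last split => //.
  by have := congr1 (reindex (@lshift n p)) E; rewrite reindex_lshift reindex_comp.
by have := congr1 (reindex (@rshift n p)) E; rewrite reindex_rshift reindex_comp.
Qed.

Lemma cartD m p (A B : set (m.-tuple G)) (C : set (p.-tuple G)) :
  cart (A `\` B) C = cart A C `\` cart B C.
Proof.
apply/seteqP; split=> z; rewrite /setD /= !cartE /=; tauto.
Qed.

Lemma cartS m p (A B : set (m.-tuple G)) (C : set (p.-tuple G)) :
  B `<=` A -> cart B C `<=` cart A C.
Proof. by move=> BA z /cartE[Bz Cz]; apply/cartE; split=> //; apply: BA. Qed.

Lemma definable_bijection_cartC m n (A : set (m.-tuple G)) (B : set (n.-tuple G)) :
  definable A -> definable B -> definable_bijection (cart A B) (cart B A).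
Proof.
move=> dA dB.
pose r k l (i : 'I_(l + k)) : 'I_(k + l) :=
  match fintype.split i with inl j => rshift k j | inr j => lshift l j end.
have rl k l : @r k l \o @lshift l k = @rshift k l.
  by apply/funext => i; rewrite /r /= (unsplitK (inl i)).
have rr k l : @r k l \o @rshift l k = @lshift k l.
  by apply/funext => i; rewrite /r /= (unsplitK (inr i)).
clearbody r.
have rK k l (z : (k + l).-tuple G) : reindex (@r l k) (reindex (@r k l) z) = z.
  by rewrite -[LHS]cat_reindex !reindex_comp (rl l k) (rr l k) (rl k l) (rr k l) cat_reindex.
apply: (@definable_bij_reindex _ _ (@r m n)); first exact: definable_cart.
split.
- by move=> z /cartE[Az Bz]; apply/cartE; rewrite !reindex_comp rl rr.
- by move=> z z' _ _ /(congr1 (reindex (@r n m))); rewrite !rK.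
- move=> w /cartE[Bw Aw]; exists (reindex (@r n m) w); last exact: rK.
  by apply/cartE; rewrite !reindex_comp rl rr.
Qed.

Lemma definable_bijection_cartA m n p (A : set (m.-tuple G))
    (B : set (n.-tuple G)) (C : set (p.-tuple G)) :
  definable A -> definable B -> definable C ->
  definable_bijection (cart A (cart B C)) (cart (cart A B) C).
Proof.
move=> dA dB dC; have E := addnA m n p.
have rK : cancel (reindex (cast_ord E) : _ -> _.-tuple G)
    (reindex (cast_ord (esym E))).
  by move=> z; apply: eq_from_tnth => i; rewrite !tnth_reindex cast_ordKV.
have rK' : cancel (reindex (cast_ord (esym E)) : _ -> _.-tuple G)
    (reindex (cast_ord E)).
  by move=> z; apply: eq_from_tnth => i; rewrite !tnth_reindex cast_ordK.
have H z : cart (cart A B) C (reindex (cast_ord (esym E)) z)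
    <-> cart A (cart B C) z.
  rewrite !cartE !reindex_comp.
  have -> : cast_ord (esym E) \o (@lshift (m + n) p \o @lshift m n) = @lshift m (n + p).
    by apply/funext => i; apply/val_inj.
  have -> : cast_ord (esym E) \o (@lshift (m + n) p \o @rshift m n) =
      @rshift m (n + p) \o @lshift n p.
    by apply/funext => i; apply/val_inj.
  have -> : cast_ord (esym E) \o @rshift (m + n) p =
      @rshift m (n + p) \o @rshift n p.
    by apply/funext => i; apply/val_inj => /=; rewrite addnA.
  tauto.
apply: (@definable_bij_reindex _ _ (cast_ord (esym E))).
  by do 2?apply: definable_cart.
split.
- by move=> z /H.
- by move=> z z' _ _ /(congr1 (reindex (cast_ord E))); rewrite !rK'.
- move=> w Cw; exists (reindex (cast_ord E) w); last exact: rK.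
  by apply/H; rewrite rK.
Qed.

Lemma definable_pt (a : G) : definable [set [tuple a]].
Proof.
exists (FEq (TVar ord0) (TCst a)); apply/seteqP; split=> e /=.
  by move->; rewrite tnth0.
by move=> E; apply: eq_from_tnth => i; rewrite ord1 E tnth0.
Qed.

Lemma definable_bijection_pt (a b : G) :
  definable_bijection [set [tuple a]] [set [tuple b]].
Proof.
exists (fun=> [tuple b]).
  split=> [x //|x y|y ->]; last by exists [tuple a].
  by move=> /set_mem-> /set_mem->.
apply: definable_ext (definable_cart (definable_pt a) (definable_pt b)) _ => z.
by rewrite cartE graph_onE.
Qed.

Lemma definable_bijection_cart1 n (A : set (n.-tuple G)) (a : G) :
  definable A -> definable_bijection (cart [set [tuple a]] A) A.
Proof.
move=> dA; apply: (@definable_bij_reindex _ _ (@rshift 1 n)).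
  exact/definable_cart/dA/definable_pt.
split.
- by move=> z /cartE[].
- move=> z z' /set_mem/cartE[E _] /set_mem/cartE[E' _] E2.
  by rewrite -[z]cat_reindex -[z']cat_reindex E2 E E'.
- move=> w Aw; exists (cat_tuple [tuple a] w); last exact: reindex_rshift.
  by apply/cartE; rewrite reindex_lshift reindex_rshift.
Qed.

End Renaming.

Section DefSets.
Variable G : oagType.

(* Definable subsets of all G^n, n = 0 included. Equality in [Def] is equality
   of the ambient power and of the set ([MkDef_eq]). *)
Record Def : Type := MkDef {
  dim : nat;
  carrier : set (dim.-tuple G);
  carrierP : definable carrier
}.
Arguments carrier : clear implicits.

HB.instance Definition _ := gen_eqMixin Def.
HB.instance Definition _ := gen_choiceMixin Def.

Definition Def_prod (A B : Def) : Def :=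
  MkDef (definable_cart (carrierP A) (carrierP B)).

Definition Def_pt (a : G) : Def := MkDef (definable_pt a).

Local Notation F := {freeg Def}.

(* [<< A >>] is the generator attached to [A] in the free abelian group F. *)
Inductive relator : F -> Prop :=
| rel_bij m n (A : set (m.-tuple G)) (B : set (n.-tuple G))
    (dA : definable A) (dB : definable B) :
    definable_bijection A B -> relator (<< MkDef dA >> - << MkDef dB >>)
| rel_cut n (A B : set (n.-tuple G)) (dA : definable A) (dB : definable B) :
    B `<=` A ->
    relator (<< MkDef (definableD dA dB) >> + << MkDef dB >> - << MkDef dA >>).

(* Additive subgroup generated by the relators *)
Inductive in_relations : F -> Prop :=
| in_rel_gen x : relator x -> in_relations x
| in_rel_0 : in_relations 0
| in_rel_sub x y : in_relations x -> in_relations y -> in_relations (x - y).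

Definition relations : {pred F} := fun x => `[< in_relations x >].

Lemma relations_zmod_closed : zmod_closed relations.
Proof.
split; first exact/asboolP/in_rel_0.
by move=> x y /asboolP rx /asboolP ry; apply/asboolP/in_rel_sub.
Qed.

HB.instance Definition _ :=
  GRing.isZmodClosed.Build F relations relations_zmod_closed.

Definition KG := Quotient.quot relations.
HB.instance Definition _ := GRing.Zmodule.on KG.

Definition K_class (A : Def) : KG := \pi_KG << A >>.

(* Bilinear extension of [Def_prod] to the free abelian group *)
Definition mulF (x y : F) : F :=
  fglift (fun A => fglift (fun B => << Def_prod A B >> : F) y) x.

Definition oneK : KG := K_class (Def_pt 0).

Definition mulK (x y : KG) : KG := \pi_KG (mulF (repr x) (repr y)).

Lemma pi_eqP (x y : F) : \pi_KG x = \pi_KG y <-> x - y \in relations.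
Proof. by rewrite Quotient.idealrBE; split=> [->|/eqP]. Qed.

Lemma pi_addK (x y : F) : \pi_KG (x + y) = \pi_KG x + \pi_KG y.
Proof. exact: (Quotient.pi_add relations). Qed.

Lemma pi_oppK (x : F) : \pi_KG (- x) = - \pi_KG x.
Proof. exact: (Quotient.pi_opp relations). Qed.

Lemma pi_subK (x y : F) : \pi_KG (x - y) = \pi_KG x - \pi_KG y.
Proof. by rewrite pi_addK pi_oppK. Qed.

Lemma freeg_subind (P : F -> Prop) :
  P 0 -> (forall x y, P x -> P y -> P (x - y)) -> (forall A, P << A >>) ->
  forall x, P x.
Proof.
move=> P0 PB PU.
have PN x : P x -> P (- x) by rewrite -sub0r; exact: PB.
have PD x y : P x -> P y -> P (x + y).
  by move=> Px Py; rewrite -[y]opprK; apply/PB/PN.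
have Pn x n : P x -> P (x *+ n).
  by move=> Px; elim: n => [|n IH]; rewrite ?mulr0n ?mulrS //; exact: PD.
move=> x; rewrite -[x]freeg_sumE; apply: big_ind => // A _.
rewrite -[coeff A x]intz -freegU_mulz.
by case: (coeff A x) => n; [|rewrite NegzE mulrNz; apply: PN];
  rewrite -pmulrn; apply: Pn.
Qed.

Lemma fgliftB (f : Def -> F) x y : fglift f (x - y) = fglift f x - fglift f y.
Proof. exact: (@lift_is_additive _ _ _ f x y). Qed.

Lemma fglift0 (f : Def -> F) : fglift f 0 = 0.
Proof. by have := fgliftB f 0 0; rewrite !subrr. Qed.

Lemma fgliftU1 (f : Def -> F) A : fglift f << A >> = f A.
Proof. by rewrite liftU scale1r. Qed.

Lemma mulFU A B : mulF << A >> << B >> = << Def_prod A B >>.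
Proof. by rewrite /mulF !fgliftU1. Qed.

Lemma mulFBl x y z : mulF (x - y) z = mulF x z - mulF y z.
Proof. exact: fgliftB. Qed.

Lemma mulF0l z : mulF 0 z = 0.
Proof. exact: fglift0. Qed.

Lemma mulFBr x y z : mulF x (y - z) = mulF x y - mulF x z.
Proof.
elim/@freeg_subind: x => [|x x' IH IH'|A]; first by rewrite !mulF0l subrr.
  by rewrite !mulFBl IH IH' !opprB addrACA [RHS]addrACA [z in _ + z]addrC.
by rewrite /mulF !fgliftU1 fgliftB.
Qed.

Lemma mulF0r x : mulF x 0 = 0.
Proof. by have := mulFBr x 0 0; rewrite !subrr. Qed.

Lemma mulFDl x y z : mulF (x + y) z = mulF x z + mulF y z.
Proof.
have N : mulF (- y) z = - mulF y z by rewrite -[- y]sub0r mulFBl mulF0l sub0r.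
by rewrite -{1}[y]opprK mulFBl N opprK.
Qed.

Lemma MkDef_eq n (A B : set (n.-tuple G)) (dA : definable A) (dB : definable B) :
  A = B -> MkDef dA = MkDef dB.
Proof. by move=> AB; case: _ / AB dB => dB; congr MkDef; apply: Prop_irrelevance. Qed.

Lemma pi_bij (A B : Def) :
  definable_bijection (carrier A) (carrier B) -> \pi_KG << A >> = \pi_KG << B >>.
Proof.
case: A B => [m A dA] [n B dB] /= AB.
exact/pi_eqP/asboolP/in_rel_gen/rel_bij.
Qed.

Lemma relations_mulr x y : x \in relations -> mulF x y \in relations.
Proof.
move=> /asboolP; elim=> {x} [x rx||x x' _ IH _ IH']; last 2 first.
- by rewrite mulF0l rpred0.
- by rewrite mulFBl rpredB.
elim/@freeg_subind: y => [|y y' IH IH'|[p C dC]]; first by rewrite mulF0r rpred0.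
  by rewrite mulFBr rpredB.
case: rx => [m n A B dA dB AB|n A B dA dB BA].
  rewrite mulFBl !mulFU; apply/asboolP/in_rel_gen/rel_bij => /=.
  exact: definable_bijection_cart.
rewrite mulFBl mulFDl !mulFU /Def_prod /=.
have dAC := definable_cart dA dC; have dBC := definable_cart dB dC.
have := in_rel_gen (rel_cut dAC dBC (cartS BA)).
rewrite (MkDef_eq (definableD dAC dBC)
  (definable_cart (definableD dA dB) dC) (esym (cartD A B C))).
rewrite (MkDef_eq dAC (definable_cart dA dC) erefl).
by rewrite (MkDef_eq dBC (definable_cart dB dC) erefl) => H; apply/asboolP.
Qed.

Lemma pi_mulC x y : \pi_KG (mulF x y) = \pi_KG (mulF y x).
Proof.
elim/@freeg_subind: x => [|x x' IH IH'|A]; first by rewrite mulF0l mulF0r.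
  by rewrite mulFBl mulFBr !pi_subK IH IH'.
elim/@freeg_subind: y => [|y y' IH IH'|B]; first by rewrite mulF0l mulF0r.
  by rewrite mulFBl mulFBr !pi_subK IH IH'.
by rewrite !mulFU; apply/pi_bij/definable_bijection_cartC/carrierP/carrierP.
Qed.

Lemma pi_mul x y : \pi_KG (mulF x y) = mulK (\pi_KG x) (\pi_KG y).
Proof.
have cl u u' v : \pi_KG u = \pi_KG u' -> \pi_KG (mulF u v) = \pi_KG (mulF u' v).
  by move=> /pi_eqP/(relations_mulr v); rewrite mulFBl => /pi_eqP.
rewrite /mulK (cl _ (repr (\pi_KG x))) ?reprK // pi_mulC.
by rewrite (cl _ (repr (\pi_KG y))) ?reprK // pi_mulC.
Qed.

Lemma mulKC : commutative mulK.
Proof. by move=> x y; exact: pi_mulC. Qed.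

Lemma pi_mulA x y z : \pi_KG (mulF x (mulF y z)) = \pi_KG (mulF (mulF x y) z).
Proof.
elim/@freeg_subind: x => [|x x' IH IH'|A]; first by rewrite !mulF0l.
  by rewrite !mulFBl !pi_subK IH IH'.
elim/@freeg_subind: y => [|y y' IH IH'|B].
- by rewrite !(mulF0l, mulF0r).
- by rewrite !(mulFBl, mulFBr) !pi_subK IH IH'.
elim/@freeg_subind: z => [|z z' IH IH'|C]; first by rewrite !mulF0r.
  by rewrite !mulFBr !pi_subK IH IH'.
by rewrite !mulFU; apply/pi_bij/definable_bijection_cartA; exact: carrierP.
Qed.

Lemma mulKA : associative mulK.
Proof.
elim/quotW=> x; elim/quotW=> y; elim/quotW=> z.
rewrite -(pi_mul y z) -(pi_mul x y) -(pi_mul x (mulF y z)) pi_mulA.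
exact: pi_mul.
Qed.

Lemma mul1K : left_id oneK mulK.
Proof.
elim/quotW=> x; rewrite -(pi_mul << Def_pt 0 >> x).
elim/@freeg_subind: x => [|x x' IH IH'|A]; first by rewrite mulF0r.
  by rewrite mulFBr !pi_subK IH IH'.
by rewrite mulFU; apply/pi_bij/definable_bijection_cart1/carrierP.
Qed.

Lemma mulKDl : left_distributive mulK +%R.
Proof.
elim/quotW=> x; elim/quotW=> y; elim/quotW=> z.
by rewrite -pi_addK -(pi_mul (x + y) z) mulFDl pi_addK !pi_mul.
Qed.

HB.instance Definition _ :=
  GRing.Zmodule_isComPzRing.Build KG mulKA mulKC mul1K mulKDl.

Lemma K_class_bij (A B : Def) :
  definable_bijection (carrier A) (carrier B) -> K_class A = K_class B.
Proof. exact: pi_bij. Qed.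

Lemma K_class_cut n (A B : set (n.-tuple G)) (dA : definable A)
    (dB : definable B) :
  B `<=` A ->
  K_class (MkDef (definableD dA dB)) + K_class (MkDef dB) = K_class (MkDef dA).
Proof.
by move=> BA; rewrite /K_class -pi_addK; apply/pi_eqP/asboolP/in_rel_gen/rel_cut.
Qed.

Lemma K_classM (A B : Def) : K_class A * K_class B = K_class (Def_prod A B).
Proof. by rewrite /K_class -mulFU; exact: esym (pi_mul _ _). Qed.

Lemma K_class_pt (a : G) : K_class (Def_pt a) = 1.
Proof. exact/pi_bij/definable_bijection_pt. Qed.

Lemma K_class0 n : K_class (MkDef (definable_set0 G n)) = 0.
Proof.
have := K_class_cut (definable_set0 G n) (definable_set0 G n) (@subset_refl _ _).
rewrite (MkDef_eq (definableD _ _) (definable_set0 G n)) ?setD0 //.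
by rewrite -[RHS]add0r => /addIr.
Qed.

End DefSets.

(* Main.v *)
(* Let H = nG be a proper subgroup, g = [H] and y_c = [{x in c + H | x > 0}].
   Reflection gives g = 2 y_0 + 1, and y_c + y_(-c) = g for c outside H. Cutting
   a product of two such sets along the diagonal and applying the shear
   (x, y) |-> (x, y - x) gives
     y_c y_d = y_c y_(d-c) + y_d y_(c-d)   (plus y_c if c - d is in H).
   Hence g^2 = 1, y_c^2 = g y_c, and the idempotents g y_c behave like a positive
   cone on G/H: y_c y_(-c) = 0, and g y_c y_d = y_c y_d y_(c+d) as long as d and
   c + d are outside H. As G/H has torsion it has no such cone: if m is the order
   of b modulo H, then g y_b = y_b y_((m-1)b) = y_b y_(-b) = 0. So y_b = 0 for all
   b outside H, whence g = y_b + y_(-b) = 0 and 1 = g^2 = 0. *)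
From mathcomp Require Import all_boot all_order all_algebra.
From mathcomp Require Import classical_sets functions boolp.
From mathcomp Require Import ring.
Require Import Defs.

Set Implicit Arguments.
Unset Strict Implicit.
Unset Printing Implicit Defensive.

Import Order.TTheory GRing.Theory.

Local Open Scope ring_scope.

(** * Order and signs in an ordered abelian group *)

Section OrderedGroup.
Variable G : oagType.
Implicit Types x y z : G.

Lemma oag_ltD2l z x y : x < y -> z + x < z + y.
Proof.
rewrite !lt_def => /andP[xy /(oag_leD2l z)->].
by rewrite (inj_eq (addrI z)) xy.
Qed.

Lemma oag_subr_gt0 x y : (0 < y - x) = (x < y).
Proof.
by apply/idP/idP => [/(oag_ltD2l x)|/(oag_ltD2l (- x))];
  rewrite ?addr0 ?addNr 1?addrC // subrK.
Qed.

Lemma oag_oppr_gt0 x : (0 < - x) = (x < 0).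
Proof. by rewrite -sub0r oag_subr_gt0. Qed.

Lemma oag_oppr_lt0 x : (- x < 0) = (0 < x).
Proof. by rewrite -oag_oppr_gt0 opprK. Qed.

Lemma oag_neq_lt x y : x <> y -> x < y \/ y < x.
Proof.
move=> /eqP xy; have /orP[] := oag_le_total x y => h; [left|right].
  by rewrite lt_def eq_sym xy.
by rewrite lt_def xy.
Qed.

End OrderedGroup.

(** * Definable bijections whose components are terms *)

Section TermMaps.
Variable G : oagType.

Definition eval_tuple m n (s : n.-tuple (oag_term G m)) (e : m.-tuple G) :
  n.-tuple G := map_tuple (eval e) s.

(** Formulas only have binary conjunctions, so the [n] coordinate equations of the graph are
    collected by induction along [enum 'I_n]. *)
Lemma definable_graph_terms m n (A : set (m.-tuple G))
    (s : n.-tuple (oag_term G m)) :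
  definable A -> definable (graph_on A (eval_tuple s)).
Proof.
move=> dA.
have dE : definable [set z : (m + n).-tuple G | forall i, i \in enum 'I_n ->
    tnth z (rshift m i) = eval (reindex (@lshift m n) z) (tnth s i)]%classic.
  elim: (enum 'I_n) => [|i l IH].
    by apply: definable_ext (definable_setT G _) _ => z; split.
  have di : definable [set z : (m + n).-tuple G |
      tnth z (rshift m i) = eval (reindex (@lshift m n) z) (tnth s i)]%classic.
    exists (FEq (TVar (rshift m i)) (ren_term (@lshift m n) (tnth s i))).
    by apply/seteqP; split=> z /=; rewrite eval_ren.
  apply: definable_ext (definableI di IH) _ => z; split=> /=.
    by move=> [ei H] j; rewrite inE => /predU1P[->|/H].
  by move=> H; split=> [|j jl]; apply: H; rewrite inE ?eqxx // jl orbT.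
have := definableI (definable_reindex (@lshift m n) dA) dE.
move/definable_ext; apply=> z; rewrite graph_onE; split=> -[Az H]; split=> //.
  by apply: eq_from_tnth => i; rewrite tnth_reindex tnth_map H ?mem_enum.
by move=> i _; rewrite -tnth_reindex H tnth_map.
Qed.

(** The reflection, translation, shear, swap and diagonal projection used below, and their inverses,
    are all given by terms; each is thus reduced to two pointwise checks. *)
Lemma definable_bijection_terms m n (A : set (m.-tuple G)) (B : set (n.-tuple G))
    (s : n.-tuple (oag_term G m)) (t : m.-tuple (oag_term G n)) :
  definable A ->
  (forall x, A x -> B (eval_tuple s x) /\ eval_tuple t (eval_tuple s x) = x) ->
  (forall y, B y -> A (eval_tuple t y) /\ eval_tuple s (eval_tuple t y) = y) ->
  definable_bijection A B.
Proof.
move=> dA AB BA; exists (eval_tuple s); last exact: definable_graph_terms.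
split=> [x /AB[]//|x x' /set_mem/AB[_ Ex] /set_mem/AB[_ Ex'] E|y /BA[Ay Ey]].
  by rewrite -Ex E Ex'.
by exists (eval_tuple t y).
Qed.

End TermMaps.

(** * Classes of definable sets and the relations between them *)

Section ClassOfSet.
Variable G : oagType.

Definition cls n (A : set (n.-tuple G)) (dA : definable A) : KG G :=
  K_class (MkDef dA).

Lemma cls_eq n (A B : set (n.-tuple G)) (dA : definable A) (dB : definable B) :
  (forall x, A x <-> B x) -> cls dA = cls dB.
Proof. by move=> AB; rewrite /cls (MkDef_eq dA dB) //; apply/predeqP. Qed.

Lemma cls_disjoint_union n (A B C : set (n.-tuple G)) (dA : definable A)
    (dB : definable B) (dC : definable C) :
  (forall x, C x <-> A x \/ B x) -> (forall x, A x -> B x -> False) ->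
  cls dC = cls dA + cls dB.
Proof.
move=> CE AB; rewrite [LHS]/cls -(K_class_cut dC dB) => [|x Bx];
  last by apply/CE; right.
congr (_ + _); apply: cls_eq => x; rewrite /setD /= CE.
by split=> [[[]]//|Ax]; split; [left|move/(AB _ Ax)].
Qed.

Lemma cls_bij m n (A : set (m.-tuple G)) (B : set (n.-tuple G))
    (dA : definable A) (dB : definable B) :
  definable_bijection A B -> cls dA = cls dB.
Proof. exact: (@K_class_bij _ (MkDef dA) (MkDef dB)). Qed.

Lemma clsM m n (A : set (m.-tuple G)) (B : set (n.-tuple G))
    (dA : definable A) (dB : definable B) :
  cls dA * cls dB = cls (definable_cart dA dB).
Proof. exact: (@K_classM _ (MkDef dA) (MkDef dB)). Qed.

Lemma cart_tuple2E (A B : set (1.-tuple G)) (x y : G) :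
  cart A B [tuple x; y] <-> A [tuple x] /\ B [tuple y].
Proof.
have -> : [tuple x; y] = cat_tuple [tuple x] [tuple y] by apply: val_inj.
by rewrite cartE reindex_lshift reindex_rshift.
Qed.

End ClassOfSet.

(** * Cosets of H = nG and their positive parts *)

Section Cosets.
Variables (G : oagType) (n : nat).
Implicit Types (b c d x y : G) (e : 1.-tuple G).

Definition multiple x : Prop := exists h : G, h *+ n = x.

Lemma multiple0 : multiple 0.
Proof. by exists 0; rewrite mul0rn. Qed.

Lemma multipleN x : multiple x -> multiple (- x).
Proof. by case=> h <-; exists (- h); rewrite mulNrn. Qed.

Lemma multipleD x y : multiple x -> multiple y -> multiple (x + y).
Proof. by case=> h <- [k <-]; exists (h + k); rewrite mulrnDl. Qed.

Lemma multipleB x y : multiple x -> multiple y -> multiple (x - y).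
Proof. by move=> mx my; apply/multipleD/multipleN. Qed.

Definition coset c : set (1.-tuple G) :=
  [set e | multiple (thead e - c)]%classic.
Definition pos : set (1.-tuple G) := [set e | 0 < thead e]%classic.
Definition neg : set (1.-tuple G) := [set e | thead e < 0]%classic.

Lemma definable_coset c : definable (coset c).
Proof.
(* As [n] is a fixed integer, the [n]-fold sum of the bound variable is a term. Under the
   quantifier, [ord0] is the witness h and [ord_max] is the point of the coset. *)
pose t := iter n (TAdd (TVar ord0)) TZero : oag_term G 2.
have tE (e : 2.-tuple G) : eval e t = tnth e ord0 *+ n.
  by rewrite /t; elim: n => [|k IH] //=; rewrite IH mulrS.
have maxE (e : 1.-tuple G) h : tnth (cons_tuple h e) ord_max = thead e.
  by rewrite (_ : ord_max = fintype.lift ord0 ord0) ?tnthS //; exact: val_inj.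
clearbody t; exists (FEx (FEq t (TAdd (TVar ord_max) (TOpp (TCst c))))).
by apply/seteqP; split=> e [h E]; exists h; move: E; rewrite /= tE maxE tnth0.
Qed.

Lemma definable_pos : definable pos.
Proof. by exists (FLt TZero (TVar ord0)). Qed.

Lemma definable_neg : definable neg.
Proof. by exists (FLt (TVar ord0) TZero). Qed.

Definition pcoset c := (coset c `&` pos)%classic.
Definition ncoset c := (coset c `&` neg)%classic.

Lemma definable_pcoset c : definable (pcoset c).
Proof. exact/definableI/definable_pos/definable_coset. Qed.

Lemma definable_ncoset c : definable (ncoset c).
Proof. exact/definableI/definable_neg/definable_coset. Qed.

(** These are the y_c and g of the overview, membership in H being [multiple]. *)
Local Notation Y c := (cls (definable_pcoset c)).
Local Notation g := (cls (definable_coset 0)).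

Lemma cls_pcoset_mod c d : multiple (c - d) -> Y c = Y d.
Proof.
move=> cd; apply: cls_eq => x; rewrite /pcoset /coset /setI /=.
split=> -[xc x0]; split=> //.
  by have := multipleD xc cd; rewrite addrA subrK.
by have := multipleB xc cd; rewrite opprB addrA subrK.
Qed.

Lemma cls_ncoset c : cls (definable_ncoset c) = Y (- c).
Proof.
apply/cls_bij/(definable_bijection_terms (s := [tuple TOpp (TVar ord0)])
  (t := [tuple TOpp (TVar ord0)]) (definable_ncoset c)) => x;
  case/tupleP: x => x e; rewrite (tuple0 e) => -[/= xc x0].
  split; last by apply: val_inj; rewrite /= opprK.
  split; last by rewrite /= /pos /= oag_oppr_gt0.
  by rewrite /coset /= -opprD; exact: multipleN.
split; last by apply: val_inj; rewrite /= opprK.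
split; last by rewrite /= /neg /= oag_oppr_lt0.
by rewrite /coset /= -opprD; apply: multipleN; rewrite -[c]opprK.
Qed.

(** Translation by [- c] carries c + H onto H. *)
Lemma cls_coset c : cls (definable_coset c) = g.
Proof.
apply/cls_bij/(definable_bijection_terms
  (s := [tuple TAdd (TVar ord0) (TOpp (TCst c))])
  (t := [tuple TAdd (TVar ord0) (TCst c)]) (definable_coset c)) => x;
  case/tupleP: x => x e; rewrite (tuple0 e) /coset /= => xc.
  by split; [rewrite /= subr0|apply: val_inj; rewrite /= subrK].
by split; [rewrite /= addrK -[x]subr0|apply: val_inj; rewrite /= addrK].
Qed.

(** As 0 lies outside c + H, this coset consists of its positive and negative parts, and reflection
    identifies the class of the negative one. *)
Lemma cls_pcosetDN c : ~ multiple c -> Y c + Y (- c) = g.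
Proof.
move=> nc; rewrite -cls_ncoset -(cls_coset c); apply/esym/cls_disjoint_union.
  move=> x; split=> [cx|[[]|[]]//].
  have /oag_neq_lt[x0|x0] : thead x <> 0.
  - move=> x0; apply: nc; rewrite -[c]opprK; apply: multipleN.
    by move: cx; rewrite /coset /= x0 sub0r.
  - by right.
  - by left.
by move=> x [_ /lt_trans H] [_ /H]; rewrite ltxx.
Qed.

Lemma cls_coset0 : g = Y 0 + Y 0 + 1.
Proof.
(* The second summand is made to stand for the negative part of H, which has the same class by
   reflection; the summand 1 comes from the point 0. *)
have {2}-> : Y 0 = cls (definable_ncoset 0).
  rewrite cls_ncoset; apply: cls_pcoset_mod.
  by rewrite opprK addr0; exact: multiple0.
rewrite -(K_class_pt 0).
pose dH := definableD (definable_coset 0) (definable_pt (0 : G)).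
rewrite -(@cls_disjoint_union _ _ _ _ _ _ _ dH).
- rewrite [LHS]/cls -(K_class_cut _ (definable_pt 0)) // => x ->.
  by rewrite /coset /= subr0; exact: multiple0.
- move=> x; split=> [[cx nx]|].
    have /oag_neq_lt[x0|x0] : thead x <> 0.
    + by move=> x0; apply: nx; apply: eq_from_tnth => i; rewrite ord1 tnth0 -x0.
    + by right.
    + by left.
  by case=> -[cx x0]; split=> // xE; move: x0; rewrite xE /pos /neg /= ltxx.
- by move=> x [_ /lt_trans H] [_ /H]; rewrite ltxx.
Qed.

(** * Products of two positive parts, cut along the diagonal *)

Lemma eval_tuple2 m (t u : oag_term G m) (e : m.-tuple G) :
  eval_tuple [tuple t; u] e = [tuple eval e t; eval e u].
Proof. exact: val_inj. Qed.

Definition upper : set (2.-tuple G) :=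
  [set z | tnth z ord0 < tnth z ord_max]%classic.
Definition lower : set (2.-tuple G) :=
  [set z | tnth z ord_max < tnth z ord0]%classic.
Definition diagonal : set (2.-tuple G) :=
  [set z | tnth z ord0 = tnth z ord_max]%classic.

Lemma definable_upper : definable upper.
Proof. by exists (FLt (TVar ord0) (TVar ord_max)). Qed.

Lemma definable_lower : definable lower.
Proof. by exists (FLt (TVar ord_max) (TVar ord0)). Qed.

Lemma definable_diagonal : definable diagonal.
Proof. by exists (FEq (TVar ord0) (TVar ord_max)). Qed.

Definition quadrant c d : set (2.-tuple G) := cart (pcoset c) (pcoset d).

Lemma definable_quadrant c d : definable (quadrant c d).
Proof. exact: (definable_cart (definable_pcoset c) (definable_pcoset d)). Qed.

(** The shear (x, y) |-> (x, y - x) turns x < y into positivity of the second coordinate and moves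
    that coordinate from d + H to (d - c) + H. *)
Lemma cls_upper c d :
  cls (definableI (definable_quadrant c d) definable_upper) = Y c * Y (d - c).
Proof.
rewrite clsM; apply/cls_bij/(definable_bijection_terms
  (s := [tuple TVar ord0; TAdd (TVar ord_max) (TOpp (TVar ord0))])
  (t := [tuple TVar ord0; TAdd (TVar ord0) (TVar ord_max)])).
- exact/definableI/definable_upper/definable_quadrant.
- move=> z; case/tupleP: z => x z; case/tupleP: z => y z; rewrite (tuple0 z).
  move=> [/cart_tuple2E[[/= xc x0] [/= yd y0]] xy].
  rewrite !eval_tuple2 /=; split; last by apply: val_inj; rewrite /= [x + _]addrC subrK.
  apply/cart_tuple2E; split=> //; split; last by rewrite /pos /= oag_subr_gt0.
  rewrite /coset /= (_ : _ - _ = (y - d) - (x - c)); first exact: multipleB.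
  by rewrite !opprB addrACA [RHS]addrACA [- x - d]addrC.
- move=> z; case/tupleP: z => x z; case/tupleP: z => y z; rewrite (tuple0 z).
  move=> /cart_tuple2E[[/= xc x0] [/= ydc y0]].
  rewrite !eval_tuple2 /=; split; last first.
    by apply: val_inj; rewrite /= addrAC subrr add0r.
  (* For the inverse shear, 0 < y gives x < x + y, and 0 < x then gives 0 < x + y. *)
  have xxy : x < x + y by rewrite -[x in x < _]addr0; exact: oag_ltD2l.
  split=> //; apply/cart_tuple2E; split=> //; split; last exact: lt_trans xxy.
  by have := multipleD xc ydc; rewrite /coset /= addrACA -opprD [c + _]addrC subrK.
Qed.

(** Swapping the coordinates reduces this to [cls_upper] with [c] and [d] exchanged. *)
Lemma cls_lower c d :
  cls (definableI (definable_quadrant c d) definable_lower) = Y d * Y (c - d).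
Proof.
rewrite -cls_upper; apply/cls_bij/(definable_bijection_terms
  (s := [tuple TVar ord_max; TVar ord0]) (t := [tuple TVar ord_max; TVar ord0])).
- exact/definableI/definable_lower/definable_quadrant.
- move=> z; case/tupleP: z => x z; case/tupleP: z => y z; rewrite (tuple0 z).
  move=> [/cart_tuple2E[cx dy] xy]; rewrite !eval_tuple2 /=.
  by split; [split=> //; apply/cart_tuple2E|apply: val_inj].
- move=> z; case/tupleP: z => x z; case/tupleP: z => y z; rewrite (tuple0 z).
  move=> [/cart_tuple2E[cx dy] xy]; rewrite !eval_tuple2 /=.
  by split; [split=> //; apply/cart_tuple2E|apply: val_inj].
Qed.

Lemma cls_diagonal c d : multiple (c - d) ->
  cls (definableI (definable_quadrant c d) definable_diagonal) = Y c.
Proof.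
move=> cd; apply/cls_bij/(definable_bijection_terms
  (s := [tuple TVar ord0]) (t := [tuple TVar ord0; TVar ord0])).
- exact/definableI/definable_diagonal/definable_quadrant.
- move=> z; case/tupleP: z => x z; case/tupleP: z => y z; rewrite (tuple0 z).
  move=> [/cart_tuple2E[cx dy] xy]; have {}xy : x = y := xy.
  rewrite eval_tuple2 /= (_ : eval_tuple _ _ = [tuple x]); last exact: val_inj.
  by split=> //; apply: val_inj; rewrite /= -xy.
- move=> x; case/tupleP: x => x e; rewrite (tuple0 e) => cx.
  rewrite eval_tuple2 /=; split; last exact: val_inj.
  split=> //; apply/cart_tuple2E; split=> //; case: cx => cx x0; split=> //.
  by have := multipleD cx cd; rewrite addrA subrK.
Qed.

(** The cosets of [c] and [d] are disjoint, so the quadrant misses the diagonal. *)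
Lemma cls_pcosetM c d : ~ multiple (c - d) ->
  Y c * Y d = Y c * Y (d - c) + Y d * Y (c - d).
Proof.
move=> ncd; rewrite -cls_upper -cls_lower clsM; apply: cls_disjoint_union.
  move=> z; split=> [qz|[[]|[]]//].
  have /oag_neq_lt[xy|xy] : tnth z ord0 <> tnth z ord_max; last 2 first.
  - by left.
  - by right.
  move: qz; case/tupleP: z => x z; case/tupleP: z => y z; rewrite (tuple0 z).
  move=> /cart_tuple2E[[/= xc _] [/= yd _]] xy.
  have xyE : x = y := xy.
  by apply: ncd; have := multipleB yd xc; rewrite /= xyE opprB addrC addrA subrK.
by move=> z [_ /lt_trans H] [_ /H]; rewrite ltxx.
Qed.

Lemma cls_pcoset_sqr c : Y c * Y c = Y c * Y 0 + Y c * Y 0 + Y c.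
Proof.
have cc : multiple (c - c) by rewrite subrr; exact: multiple0.
(* Writing [Y 0] as [Y (c - c)] exposes the products in [cls_upper] and [cls_lower]. *)
have <- : Y (c - c) = Y 0 by apply: cls_pcoset_mod; rewrite subr0.
rewrite -{1}cls_upper -cls_lower -{3}(cls_diagonal cc) clsM.
(* The three pieces are joined by two binary disjoint unions; this is the intermediate one. *)
have dUL : definable (quadrant c c `&` upper `|` quadrant c c `&` lower)%classic.
  rewrite -setIUr; apply: definableI; first exact: definable_quadrant.
  by exists (FOr (FLt (TVar ord0) (TVar ord_max)) (FLt (TVar ord_max) (TVar ord0))).
rewrite -(@cls_disjoint_union _ _ _ _ _ _ _ dUL) //.
  apply: cls_disjoint_union.
    move=> z; split=> [qz|[[[]|[]]|[]]//].
    have [xy|/oag_neq_lt[xy|xy]] := pselect (tnth z ord0 = tnth z ord_max).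
    - by right.
    - by left; left.
    - by left; right.
  by move=> z [] [_ lt] [_ eq]; move: lt; rewrite /upper /lower /= eq ltxx.
by move=> z [_ /lt_trans H] [_ /H]; rewrite ltxx.
Qed.

(** * Idempotents and the vanishing of y_b *)

Lemma cls_multiples_sqr : g * g = 1.
Proof.
(* Cancelling one [Y 0 * Y 0] leaves [0 = Y 0 * Y 0 + Y 0], and four times the right side is what
   the square of 2 y_0 + 1 has beyond 1. *)
have := cls_pcoset_sqr 0; rewrite -addrA -[LHS]addr0 => /addrI X2.
rewrite cls_coset0 (_ : _ * _ = (Y 0 * Y 0 + Y 0) *+ 4 + 1) ?addr0; last by ring.
by rewrite -X2 mul0rn add0r.
Qed.

Lemma cls_pcoset_idem c : Y c * Y c = Y c * g.
Proof. by rewrite cls_pcoset_sqr cls_coset0; ring. Qed.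

(** Expanding g as y_c + y_(-c) in y_c^2 = y_c g leaves only this product. *)
Lemma cls_pcosetMN c : ~ multiple c -> Y c * Y (- c) = 0.
Proof.
move=> /cls_pcosetDN cN; have := cls_pcoset_idem c; rewrite -cN mulrDr.
by rewrite -[LHS]addr0 => /addrI.
Qed.

(** This plays the part of closure of a positive cone under addition. Since g = y_(c+d) +
    y_(-(c+d)), it amounts to y_c y_d y_(-(c+d)) = 0. *)
Lemma cls_pcosetMM c d : ~ multiple d -> ~ multiple (c + d) ->
  Y c * Y d * Y (c + d) = Y c * Y d * g.
Proof.
move=> nd ncd; rewrite -(cls_pcosetDN ncd) mulrDr.
(* The product formula for y_c y_(-d) contains y_c y_(-(c+d)); multiplying by y_d kills every other
   term, as y_d y_(-d) = 0. *)
have := @cls_pcosetM c (- d); rewrite opprK -opprD [d + c]addrC => /(_ ncd).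
move=> /(congr1 ( *%R (Y d))).
rewrite mulrDr [_ * (Y (- d) * _)]mulrA mulrCA cls_pcosetMN // mulr0 mul0r addr0.
by rewrite mulrA [Y d * _]mulrC => <-; rewrite addr0.
Qed.

Lemma cls_pcoset_eq0 b : (0 < n)%N -> ~ multiple b -> Y b = 0.
Proof.
move=> n0 nb.
have mP : exists m, (0 < m)%N && `[< multiple (b *+ m) >].
  by exists n; rewrite n0; apply/asboolP; exists b.
(* The order of [b] modulo H exists because n b lies in H. It is not 1, so it is written [m.+2]. *)
case: (ex_minnP mP) => [[|[|m]] // /andP[_ /asboolP mb] m_min].
  by case: nb; rewrite -[b]mulr1n.
have nk k : (k <= m)%N -> ~ multiple (b *+ k.+1).
  move=> km bk; have /(m_min k.+1) : (0 < k.+1)%N && `[< multiple (b *+ k.+1) >].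
    exact/asboolP.
  by rewrite ltnNge ltnS km.
(* Induction through the multiples of [b] below its order; each step leaves a factor g, removed
   using g^2 = 1. *)
have E k : (k <= m)%N -> Y b * Y (b *+ k.+1) = Y b * g.
  elim: k => [_|k IH km]; first by rewrite mulr1n cls_pcoset_idem.
  have := @cls_pcosetMM b (b *+ k.+1) (nk _ (ltnW km)).
  rewrite -mulrS IH ?(ltnW km) // => /(_ (nk _ km)) /(congr1 (fun z => z * g)).
  by rewrite -!mulrA [g * (_ * g)]mulrCA cls_multiples_sqr !mulr1.
(* The last multiple, (m + 1) b, is congruent to - b, so [E m] becomes 0 = y_b g with g
   invertible. *)
have mN : multiple (b *+ m.+1 - - b) by rewrite opprK -mulrSr.
have := E m (leqnn m); rewrite (cls_pcoset_mod mN) cls_pcosetMN //.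
by move=> /(congr1 (fun z => z * g)); rewrite mul0r -mulrA cls_multiples_sqr mulr1.
Qed.

End Cosets.

Theorem theorem1 (G : oagType) (HG : ~ divisible G) : forall x : KG G, x = 0.
Proof.
have [n n0 [b nb]] : exists2 n, (0 < n)%N & exists b : G, ~ multiple n b.
  apply: contrapT => nH; apply: HG => n n0 b; apply: contrapT => nb.
  by apply: nH; exists n => //; exists b.
have g2 := cls_multiples_sqr G n.
have nNb : ~ multiple n (- b) by move=> /multipleN; rewrite opprK.
(* Both summands of g = y_b + y_(-b) vanish, so g^2 = 1 becomes 0 = 1. *)
move: g2; rewrite -(cls_pcosetDN nb) !cls_pcoset_eq0 // addr0 mulr0 => e x.
by rewrite -[x]mul1r -e mul0r.
Qed.
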